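(* Let $M\subset\mathbb{R}^{n+2}$ be a hypersurface, $p_0\in M$ and $T\subset T_{p_0}M$ an $n$-dimensional subspace. Consider the sections of $M$ by hyperplanes $H\neq T_{p_0}M$ passing through $p_0$ and containing $T$. Assume that one section $H_0\cap M$ is non-degenerate at $p_0$. Then $H\cap M$ is non-degenerate at $p_0$ for every such $H$, and the affine normal vectors $\eta=\eta(H)$ of these sections at $p_0$ all belong to one plane (a $2$-dimensional linear subspace of $\mathbb{R}^{n+2}$).
   Context: Everything is smooth and local near $p_0$; $D$ is the standard flat connection and $[\cdot,\dots,\cdot]$ the determinant in $\mathbb{R}^{n+2}$. $N=M\cap H$ is, near $p_0$, an $n$-dimensional submanifold of $M$ with $T_{p_0}N=T$. Non-degeneracy: choosing $\eta$ along $N$ transversal to $M$ and $\xi$ along $N$ tangent to $M$ and transversal to $N$, write $D_XY=\nabla_XY+h^1(X,Y)\xi+h^2(X,Y)\eta$ with $\nabla_XY$ tangent to $N$; $N$ is non-degenerate if $h^2$ is a non-degenerate bilinear form (independent of choices; for $N=M\cap H$ this means that $N$ is a non-degenerate hypersurface of $H$). In the non-degenerate case there is a unique direction along $N$, tangent to $M$ and transversal to $N$, spanned by $\xi$ with $D_X\xi$ tangent to $M$ for all $X\in TN$ (osculating Darboux direction). The affine normal vector $\eta(H)$ is the affine Blaschke normal vector at $p_0$ of the hypersurface $N\subset H$, where $H$ carries the parallel volume form $[\cdot,\dots,\cdot,\xi(p_0)]$, with $\xi(p_0)$ a fixed non-zero vector in the osculating Darboux direction at $p_0$ (another choice of parallel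 volume form only rescales $\eta(H)$). *)

(* Defs.v *)
From HB Require Import structures.
From mathcomp Require Import all_boot all_order all_algebra.
From mathcomp Require Import all_classical all_reals all_analysis.

Set Implicit Arguments.
Unset Strict Implicit.
Unset Printing Implicit Defensive.

Import Order.TTheory GRing.Theory Num.Theory.
Import numFieldNormedType.Exports.

Local Open Scope classical_set_scope.
Local Open Scope ring_scope.

(* C^k on an open set U: all iterated directional derivatives up to order k
   exist and are continuous (those of order < k being Frechet differentiable). *)
Fixpoint Ck_on (R : realType) (V W : normedModType R) (k : nat) (U : set V)
    (f : V -> W) : Prop :=
  if k is j.+1 then
    (forall x, U x -> differentiable f x) /\
    (forall v : V, Ck_on j U (fun x => 'D_v f x))
  else forall x, U x -> {for x, continuous f}.

Definition smooth_near (R : realType) (V W : normedModType R) (p : V)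
    (f : V -> W) : Prop :=
  exists U : set V, [/\ open U, U p & forall k, Ck_on k U f].

Section AffineGeometry.
Variables (R : realType) (n : nat).
Local Notation V := 'rV[R]_n.+2.

Implicit Types (M N : set V) (p q : V).

Definition hypersurface_near M p : Prop :=
  M p /\
  exists F : V -> R^o,
    [/\ smooth_near p F, exists v : V, 'D_v F p != 0 &
        \forall q \near p, M q <-> F q = 0].

(* Velocities at q of curves in N.  The curves need only be differentiable at
   time 0; on a submanifold this gives the same space as smooth curves do. *)
Definition tangent N q : set V := [set X |
  exists c : R -> V,
    [/\ c 0 = q, \forall t \near (0 : R), N (c t) & is_derive (0 : R) 1 c X]].

(* Fields along N are represented by smooth ambient extensions.  For X tangent
   to N at q, the flat derivative D_X Y at q is 'D_X Y q; it depends only on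
   the restriction of Y to N. *)
Definition tangent_field N p (Y : V -> V) : Prop :=
  smooth_near p Y /\ \forall q \near p, N q -> tangent N q (Y q).

(* h1 and h2 at p depend only on the values xi, eta at p of the two
   transversal fields, so only these values appear. *)
Definition nondegenerate_at M N p : Prop :=
  exists (xi eta : V) (h1 h2 : V -> V -> R),
    [/\ tangent M p xi /\ ~ tangent N p xi,
        ~ tangent M p eta,
        forall (X : V) (Y : V -> V), tangent N p X -> tangent_field N p Y ->
          tangent N p ('D_X Y p - h1 X (Y p) *: xi - h2 X (Y p) *: eta) &
        forall X : V, tangent N p X ->
          (forall Y : V, tangent N p Y -> h2 X Y = 0) -> X = 0].

Definition darboux_field M N p (xi : V -> V) : Prop :=
  smooth_near p xi /\
  \forall q \near p, N q ->
    [/\ tangent M q (xi q), ~ tangent N q (xi q) &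
        forall X : V, tangent N q X -> tangent M q ('D_X xi q)].

Definition darboux_vector M N p (xi0 : V) : Prop :=
  exists2 xi : V -> V, darboux_field M N p xi & xi p = xi0.

(* The determinant [v_1, ..., v_(n+2)]; s is meant to have n+2 entries. *)
Definition bracket (s : seq V) : R := \det (\matrix_(i < n.+2) s`_i).

(* The linear subspace W is the direction of an affine hyperplane containing N,
   with parallel volume form omega = [_, ..., _, xi0].  The three conditions on
   eta are: transversal to N inside the hyperplane; equiaffine (D_X eta tangent
   to N); and the volume form of the affine metric h, defined by
   D_X Y = nabla_X Y + h(X, Y) eta, is the induced one, i.e.
   |det h(X_i, X_j)| = omega(X_1, ..., X_n, eta)^2.
   They determine eta along N up to sign. *)
Definition blaschke_field N (W : {vspace V}) (xi0 : V) p (eta : V -> V) : Prop :=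
  smooth_near p eta /\
  \forall q \near p, N q ->
    [/\ eta q \in W /\ ~ tangent N q (eta q),
        forall X : V, tangent N q X -> tangent N q ('D_X eta q) &
        exists h : V -> V -> R,
          (forall (X : V) (Y : V -> V), tangent N q X -> tangent_field N q Y ->
             tangent N q ('D_X Y q - h X (Y q) *: eta q)) /\
          (forall X : n.-tuple V, (forall i, tangent N q (tnth X i)) ->
             `|\det (\matrix_(i < n, j < n) h (tnth X i) (tnth X j))| =
             bracket (X ++ [:: eta q; xi0]) ^+ 2)].

Definition hyperplane_through p (W : {vspace V}) : set V :=
  [set q | q - p \in W].

Definition section M p (W : {vspace V}) : set V :=
  M `&` hyperplane_through p W.

(* The hyperplane p + W contains p + T and differs from the tangent hyperplane
   of M at p. *)
Definition admissible M p (T W : {vspace V}) : Prop :=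
  [/\ \dim W = n.+1, (T <= W)%VS & [set` W] <> tangent M p].

Definition affine_normal M p (W : {vspace V}) (v : V) : Prop :=
  exists (xi0 : V) (eta : V -> V),
    [/\ darboux_vector M (section M p W) p xi0,
        blaschke_field (section M p W) W xi0 p eta &
        eta p = v].

End AffineGeometry.

(* Main.v *)
Require Import Defs.
From HB Require Import structures.
From mathcomp Require Import all_boot all_order all_algebra.
From mathcomp Require Import all_classical all_reals all_analysis.
From mathcomp Require Import perm zify ring lra.

Set Implicit Arguments.
Unset Strict Implicit.
Unset Printing Implicit Defensive.

Import Order.TTheory GRing.Theory Num.Theory.
Import numFieldNormedType.Exports.

Local Open Scope classical_set_scope.
Local Open Scope ring_scope.

(* Write M = {F = 0} near p, let (e_i) be a basis of T and let B be the matrix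
   of the second derivative D^2 F at p restricted to T.  The second fundamental
   form of the section N by H relative to a transversal field eta is
   -D^2 F / dF(eta), so every section is non-degenerate at p iff det B != 0.

   Let eta be the Blaschke field of N.  For w in H transversal to M, the
   vectors X_i = e_i - (dF(e_i)/dF(w)) w are tangent to N, and the volume
   condition reads, along N,
     det(D^2 F(X_i, X_j))^2 dF(w)^4 = const * dF(eta)^(2(n+2)).
   Choosing w with D^2 F(e_i, w) = 0 at p, only third derivatives of F survive
   in the derivative of the left-hand side at p along e_k, while
   D_X eta tangent gives e_k(dF(eta)) = D^2 F(e_k, eta).  Hence
     (n+2) D^2 F(e_k, eta) det B = dF(eta) tau_k
   with tau_k = e_k(det(D^2 F(e_i, e_j))) independent of H.  These are n
   independent linear equations on eta in R^(n+2); their solutions form the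
   plane. *)

(** * Local differentiability and symmetry of second derivatives *)

Section LocalDifferentiability.
Variables (R : realType) (V W : normedModType R).
Implicit Types f g : V -> W.

Lemma near_center0 (P : set V) x :
  (\forall y \near x, P y) <-> (\forall h \near 0, P (h + x)).
Proof.
rewrite (near_shift 0) subr0; split; apply: filterS => h //=.
Qed.

(** A first-order expansion of [f] at [x] sees only the germ of [f], so it serves [g] as well;
    uniqueness of the differential then identifies ['d g x] with ['d f x]. *)
Lemma near_eq_differentiable f g x :
  (\forall y \near x, f y = g y) -> differentiable f x -> differentiable g x.
Proof.
move=> fg dfx; have [dfc fE] := (diff_locallyP x f).1 dfx.
suff gE : g \o shift x = cst (g x) + 'd f x +o_ 0 id.
  by apply/diff_locallyP; rewrite (diff_unique dfc gE).
apply/eqaddoP => _/posnumP[e].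
move/eqaddoP : fE => /(_ e%:num) /(_ [gt0 of e%:num]); apply: filter_app.
move/near_center0 : (fg); apply: filterS => h /= fgh.
by rewrite /GRing.add/= /cst /GRing.opp /= fgh (nbhs_singleton fg).
Qed.

Lemma diff_eps f x : differentiable f x -> forall e : R, 0 < e ->
  \forall h \near 0, `|f (h + x) - f x - 'd f x h| <= e * `|h|.
Proof.
move=> /diff_locally fE e e0.
move/eqaddoP : fE => /(_ e e0); apply: filterS => h /=.
by rewrite /GRing.add/= /cst /GRing.opp /= opprD addrA.
Qed.

End LocalDifferentiability.


Lemma is_derive_curve (R : realType) (V W : normedModType R) (g : V -> W)
    (c : R -> V) t X :
  differentiable g (c t) -> is_derive t 1 c X ->
  is_derive t 1 (g \o c) ('D_X g (c t)).
Proof.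
move=> dg dc; have cd : differentiable c t by apply/derivable1_diffP.
have dgc : differentiable (g \o c) t by exact: differentiable_comp.
apply: DeriveDef; first exact: diff_derivable.
rewrite deriveE // diff_comp //= deriveE //; congr ('d g (c t) _).
by rewrite -deriveE // derive_val.
Qed.

Lemma is_derive_line (R : realType) (V : normedModType R) (u x : V) (s : R) :
  is_derive s 1 (fun t : R => t *: u + x) u.
Proof.
have H : is_diff s (fun t : R => t *: u + x) (( *:%R^~ u) + 0).
  exact: (is_diffD (is_diff_scalel s u) (is_diff_cst x s)).
have dl := @ex_diff _ _ _ _ _ _ _ H.
apply: DeriveDef; first exact: diff_derivable.
by rewrite deriveE// diff_val /GRing.add /GRing.zero /= addr0 scale1r.
Qed.

Section Schwarz.
Variables (R : realType) (V : normedModType R).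
Implicit Types (f : V -> R) (p u v : V).

(** The mean value theorem in [s] turns the second difference into [t] times a difference of two
    values of ['D_u f]. Expanding both to first order at [p] leaves two errors, each at most [e]
    times [t * (|u| + |v|)]. *)
Lemma second_difference f p u v :
  (\forall q \near p, differentiable f q) ->
  differentiable (fun q => 'D_u f q) p ->
  forall e : R, 0 < e -> \forall t \near 0^'+,
    `|f (t *: u + (t *: v + p)) - f (t *: u + p) - f (t *: v + p) + f p
      - t ^+ 2 * 'D_v ('D_u f) p| <= t ^+ 2 * (e * (2 * (`|u| + `|v|))).
Proof.
move=> df du e e0.
have /nbhs_ballP[r /= r0 rP] : nbhs 0 [set h | differentiable f (h + p) /\
  `|'D_u f (h + p) - 'D_u f p - 'd ('D_u f) p h| <= e * `|h|].
  by apply: filterI; [exact: (near_center0 _ p).1 df|exact: (diff_eps du e0)].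
have rP' h : `|h| < r -> differentiable f (h + p) /\
  `|'D_u f (h + p) - 'D_u f p - 'd ('D_u f) p h| <= e * `|h|.
  by move=> hr; apply: rP; rewrite -ball_normE /= sub0r normrN.
(* The summand 1 keeps this divisor positive when [u] and [v] both vanish. *)
have c0 : 0 < `|u| + `|v| + 1 by rewrite ltr_wpDl// addr_ge0.
near=> t.
have t0 : 0 < t by [].
have tr : t * (`|u| + `|v|) < r.
  rewrite (@le_lt_trans _ _ (t * (`|u| + `|v| + 1)))//.
    by rewrite ler_pM2l// lerDl.
  by rewrite -ltr_pdivlMr//; near: t; apply: nbhs_right_lt; rewrite divr_gt0.
have su s : 0 <= s <= t -> `|s *: u| <= t * `|u|.
  by case/andP=> s0 st; rewrite normrZ ger0_norm// ler_wpM2r.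
have suv s : 0 <= s <= t -> `|s *: u + t *: v| <= t * (`|u| + `|v|).
  move=> st; rewrite mulrDr (le_trans (ler_normD _ _))// lerD// ?su//.
  by rewrite normrZ gtr0_norm.
have su' s : 0 <= s <= t -> `|s *: u| <= t * (`|u| + `|v|).
  move=> st; rewrite (le_trans (su _ st))// ler_pM2l// lerDl//.
pose phi s := f (s *: u + (t *: v + p)) - f (s *: u + p).
have dphi s : 0 <= s <= t -> is_derive s 1 phi
    ('D_u f (s *: u + (t *: v + p)) - 'D_u f (s *: u + p)).
  move=> st.
  apply: is_deriveB.
    apply: (@is_derive_curve _ _ _ f (fun s : R => s *: u + (t *: v + p)));
      last exact: is_derive_line.
    by rewrite addrA; apply: (rP' _ _).1; exact: le_lt_trans (suv _ st) tr.
  apply: (@is_derive_curve _ _ _ f (fun s : R => s *: u + p));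
    last exact: is_derive_line.
  by apply: (rP' _ _).1; exact: le_lt_trans (su' _ st) tr.
have [||s] := @MVT _ phi (fun s =>
  'D_u f (s *: u + (t *: v + p)) - 'D_u f (s *: u + p)) 0 t t0.
- by move=> s; rewrite in_itv/= => /andP[/ltW s0 /ltW st]; apply: dphi;
  rewrite s0.
- apply: derivable_within_continuous => s; rewrite in_itv/= => st.
  by have := dphi s st.
rewrite in_itv/= => /andP[/ltW s0 /ltW st].
have {s0}st : 0 <= s <= t by rewrite s0.
rewrite subr0 /phi !scale0r !add0r => E.
have -> : f (t *: u + (t *: v + p)) - f (t *: u + p) - f (t *: v + p) + f p
  = ('D_u f (s *: u + (t *: v + p)) - 'D_u f (s *: u + p)) * t.
  by rewrite -E; ring.
have [_ A] := rP' _ (le_lt_trans (suv _ st) tr).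
have [_ B] := rP' _ (le_lt_trans (su' _ st) tr).
rewrite addrA [X in t ^+ 2 * X]deriveE//.
have -> : t ^+ 2 * 'd ('D_u f) p v = t * 'd ('D_u f) p (t *: v).
  by rewrite linearZ/= expr2 mulrA.
rewrite [_ * t]mulrC -mulrBr normrM (gtr0_norm t0) expr2 -mulrA ler_pM2l//.
have -> : 'D_u f (s *: u + t *: v + p) - 'D_u f (s *: u + p) -
  'd ('D_u f) p (t *: v)
 = ('D_u f (s *: u + t *: v + p) - 'D_u f p - 'd ('D_u f) p (s *: u + t *: v)) -
   ('D_u f (s *: u + p) - 'D_u f p - 'd ('D_u f) p (s *: u)).
  by rewrite linearD/=; ring.
rewrite (le_trans (ler_normB _ _))// (le_trans (lerD A B))//.
rewrite -mulrDr mulrCA ler_pM2l// mulr2n mulrDl mul1r mulrDr lerD//.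
  exact: suv.
exact: su'.
Unshelve. all: by end_near. Qed.

(** The second difference is symmetric in [u] and [v], and divided by [t ^+ 2] it approximates both
    mixed derivatives. *)
Lemma schwarz f p u v :
  (\forall q \near p, differentiable f q) ->
  differentiable (fun q => 'D_u f q) p ->
  differentiable (fun q => 'D_v f q) p ->
  'D_v ('D_u f) p = 'D_u ('D_v f) p.
Proof.
move=> df du dv; apply/subr0_eq/eqP; rewrite -normr_le0;
  apply/ler_addgt0Pl => e e0.
(* The two second-difference errors, taken with tolerance [e / C], add up to [e / C * (C - 1)],
   which is at most [e]. *)
rewrite addr0; pose C := 4 * (`|u| + `|v|) + 1.
have C0 : 0 < C by rewrite ltr_wpDl// mulr_ge0// addr_ge0.
have eC : 0 < e / C by rewrite divr_gt0.
have U := second_difference v df du eC; have V' := second_difference u df dv eC.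
pose T := (0 : R)^'+.
have : \forall t \near T,
    t ^+ 2 * `|'D_v ('D_u f) p - 'D_u ('D_v f) p| <= t ^+ 2 * e.
  apply: filterS3 U V' (nbhs_right_gt 0) => t A B t0.
  rewrite -[X in X * `|_|]gtr0_norm ?exprn_gt0// -normrM.
  set a := 'D_v _ p; set b := 'D_u ('D_v f) p.
  have -> : t ^+ 2 * (a - b) =
    (f (t *: v + (t *: u + p)) - f (t *: v + p) - f (t *: u + p) + f p
      - t ^+ 2 * b) -
    (f (t *: u + (t *: v + p)) - f (t *: u + p) - f (t *: v + p) + f p
      - t ^+ 2 * a).
    by rewrite [t *: v + (t *: u + p)]addrCA; ring.
  rewrite (le_trans (ler_normB _ _))// (le_trans (lerD B A))//.
  rewrite -mulrDr ler_pM2l ?exprn_gt0//.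
  rewrite (_ : _ + _ = e / C * (C - 1)); last by rewrite /C; ring.
  by rewrite mulrAC ler_pdivrMr// ler_pM2l// lerBlDr lerDl.
move=> /(filterI (nbhs_right_gt 0))/filter_ex[t [/= t0]].
by rewrite ler_pM2l ?exprn_gt0.
Qed.

End Schwarz.

(** * Smooth maps and curves in a level set *)

Section SmoothCalculus.
Variables (R : realType) (V : normedModType R).

Lemma eq_on_Ck_on (W : normedModType R) (U : set V) k (f g : V -> W) :
  open U -> (forall x, U x -> f x = g x) -> Ck_on k U f -> Ck_on k U g.
Proof.
move=> oU; elim: k f g => [|k IHk] f g fg /=.
  move=> fc x Ux; have /near_eq_cvg fgx : \forall y \near x, f y = g y.
    by apply: filterS (open_nbhs_nbhs (conj oU Ux)).
  have := fc x Ux; rewrite /prop_for /continuous_at (fg x Ux).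
  by apply: cvg_trans; exact: fgx.
case=> df Df; have fgx x : U x -> \forall y \near x, f y = g y.
  by move=> Ux; apply: filterS (open_nbhs_nbhs (conj oU Ux)).
split=> [x Ux|v]; first exact: near_eq_differentiable (fgx x Ux) (df x Ux).
by apply: IHk (Df v) => x Ux; exact: near_eq_derive (fgx x Ux).
Qed.

(** The vectors [a] and [b] are constant, so directional derivatives keep this shape and the
    induction on [k] needs no product rule. Tangent vectors are later extended to fields of this
    form. *)
Lemma Ck_on_scalel_sub (W : normedModType R) (U : set V) k (f g : V -> R^o)
    (a b : W) :
  open U -> Ck_on k U f -> Ck_on k U g ->
  Ck_on k U (fun x => f x *: a - g x *: b).
Proof.
move=> oU; elim: k f g => [|k IHk] f g /=.
  move=> fc gc x Ux; apply: cvgB; apply: cvgZr_tmp.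
    exact: fc.
  exact: gc.
case=> df Df [dg Dg].
have dfa x c : U x -> differentiable (fun y => f y *: c) x.
  by move=> Ux; apply: differentiableZl; exact: df.
have dga x c : U x -> differentiable (fun y => g y *: c) x.
  by move=> Ux; apply: differentiableZl; exact: dg.
split=> [x Ux|v]; first by apply: differentiableB; [exact: dfa|exact: dga].
apply: eq_on_Ck_on (IHk _ _ (Df v) (Dg v)) => // x Ux.
rewrite [RHS]deriveB; [|exact/diff_derivable/dfa|exact/diff_derivable/dga].
rewrite [X in _ = X - _]deriveE; last exact: dfa.
rewrite [X in _ = _ - X]deriveE; last exact: dga.
rewrite diffZl; last exact: df.
rewrite diffZl; last exact: dg.
by rewrite -!deriveE; [|exact: dg|exact: df].
Qed.

(** A weak implicit function theorem. Along [w] the value of [F] is [s * D] up to o(t), so it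
    changes sign between [s = - e * |t|] and [s = e * |t|], and the intermediate value theorem gives
    a zero between them. *)
Lemma zero_curve (F : V -> R) q X w :
  (\forall x \near q, {for x, continuous F}) -> differentiable F q ->
  F q = 0 -> 'D_X F q = 0 -> 'D_w F q != 0 ->
  exists s : R -> R, [/\ s 0 = 0, is_derive (0 : R) 1 s 0 &
    \forall t \near (0 : R), F (t *: X + s t *: w + q) = 0].
Proof.
move=> cF dF Fq0 DX0; set D : R := 'D_w F q => D0.
have near_root (e : R) : 0 < e -> \forall t \near (0 : R),
    exists2 s : R, `|s| <= e * `|t| & F (t *: X + s *: w + q) = 0.
  move=> e0; pose C := `|X| + e * `|w| + 1.
  have C0 : 0 < C by rewrite ltr_wpDl// addr_ge0// mulr_ge0// ltW.
  (* Displacements with [|s| <= e * |t|] have norm at most [|t| * C]. With this tolerance the error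
     is at most half of the linear term [e * |t| * |D|] at the endpoints, which decides the signs
     there. *)
  have De : 0 < e * `|D| / 2 / C by rewrite !divr_gt0// mulr_gt0// normr_gt0.
  have [r /= r0 rP] : exists2 r : R, 0 < r & forall h, `|h| < r ->
      {for h + q, continuous F} /\
      `|F (h + q) - F q - 'd F q h| <= e * `|D| / 2 / C * `|h|.
    have /nbhs_ballP[r /= r0 rP] : nbhs 0 [set h | {for h + q, continuous F} /\
        `|F (h + q) - F q - 'd F q h| <= e * `|D| / 2 / C * `|h|].
      by apply: filterI; [exact: (near_center0 _ q).1 cF|exact: diff_eps].
    exists r => // h hr; have := rP h; rewrite -ball_normE/= sub0r normrN.
    by move/(_ hr) => -[].
  have trC : 0 < r / C by rewrite divr_gt0.
  near=> t.
  have tr : `|t| * C < r.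
    rewrite -ltr_pdivlMr//; near: t; exact: nbhs0_lt.
  have hP (s : R) : `|s| <= e * `|t| -> `|t *: X + s *: w| <= `|t| * C.
    move=> st; rewrite (le_trans (ler_normD _ _))// !normrZ /C mulrDr mulr1.
    rewrite -[leLHS]addr0 lerD// mulrDr lerD//.
    by rewrite mulrA [`|t| * _]mulrC ler_wpM2r.
  have sgn (s : R) : `|s| <= e * `|t| ->
      `|F (t *: X + s *: w + q) - s * D| <= e * `|t| * `|D| / 2.
    move=> st; have [_] := rP _ (le_lt_trans (hP s st) tr).
    have -> : 'd F q (t *: X + s *: w) = s * D.
      by rewrite linearD !linearZ/= -!deriveE// DX0 scaler0 add0r.
    rewrite Fq0 subr0.
    move=> /le_trans; apply.
    rewrite (le_trans (ler_wpM2l _ (hP s st))) ?(ltW De)//.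
    rewrite [`|t| * C]mulrC mulrA divfK ?gt_eqF//.
    by rewrite -!mulrA ler_wpM2l ?(ltW e0)// mulrA mulrC !mulrA.
  have et0 : 0 <= e * `|t| by rewrite mulr_ge0// ltW.
  have P1 := sgn (e * `|t|); have P2 := sgn (- (e * `|t|)).
  rewrite ger0_norm// in P1; rewrite normrN ger0_norm// in P2.
  have {}P1 := P1 (lexx _); have {}P2 := P2 (lexx _).
  have [|||s] := @IVT R (fun s => F (t *: X + s *: w + q))
    (- (e * `|t|)) (e * `|t|) 0.
  - by rewrite ge0_cp.
  - apply/continuous_in_subspaceT => s; rewrite inE/= in_itv/= -ler_norml => st.
    have [cFs _] := rP _ (le_lt_trans (hP s st) tr).
    suff cl : {for s, continuous (fun s : R => t *: X + s *: w + q)}.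
      exact: (continuous_comp cl).
    by apply: cvgD; [apply: cvgD; [exact: cvg_cst|apply: cvgZr_tmp;
      exact: cvg_id]|exact: cvg_cst].
  - move: P1 P2; rewrite !ler_norml mulNr.
    have : 0 <= e * `|t| * `|D| by rewrite mulr_ge0.
    rewrite ge_min le_max; have [Dp|Dn] := leP 0 D.
      rewrite [`|D|]ger0_norm// => ? /andP[? ?] /andP[? ?].
      by apply/andP; split; apply/orP; [left|right]; lra.
    rewrite [`|D|]ltr0_norm// mulrN => ? /andP[? ?] /andP[? ?].
    by apply/andP; split; apply/orP; [right|left]; lra.
  by rewrite in_itv/= -ler_norml => st Fs; exists s.
(* Curves in [tangent] need only be differentiable at 0, so no regularity of
   [s] is required: any zero of nearly minimal modulus is o(t). *)
pose Q (t s : R) := F (t *: X + s *: w + q) = 0 /\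
  forall s', F (t *: X + s' *: w + q) = 0 -> `|s| <= `|s'| + t ^+ 2.
have Qex : \forall t \near (0 : R), exists s, Q t s.
  have := near_root 1 ltr01; apply: filterS => t [s0 _ Fs0].
  (* At [t = 0] the slack [t ^+ 2] vanishes, so the zero [s = 0] is given explicitly; elsewhere the
     slack is positive and the infimum is approached. *)
  have [->|t0] := eqVneq t 0.
    exists 0; split=> [|s' _]; first by rewrite !scale0r !add0r.
    by rewrite normr0 expr0n/= addr0.
  pose E := [set `|s| | s in [set s | F (t *: X + s *: w + q) = 0]].
  have Einf : has_inf E.
    split; first by exists `|s0|, s0.
    by exists 0 => _ [s _ <-].
  have t2 : 0 < t ^+ 2 by rewrite exprn_even_gt0.
  have [_ [s Fs <-] slt] := inf_adherent t2 Einf.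
  exists s; split=> // s' Fs'; rewrite (le_trans (ltW slt))// lerD2r.
  by apply: ge_inf; [exact: Einf.2|exists s'].
pose s t := xget 0 (Q t).
have sQ : \forall t \near (0 : R), Q t (s t).
  by apply: filterS Qex => t [s' Qs']; rewrite /s;
    case: xgetP => [_ -> //|/(_ s')].
have s00 : s 0 = 0.
  have [_ /(_ 0)] := nbhs_singleton sQ.
  rewrite !scale0r !add0r normr0 expr0n addr0 => /(_ Fq0).
  by rewrite normr_le0 => /eqP.
exists s; split=> //; last by apply: filterS sQ => t [].
have cvgs : h^-1 *: (s (h *: 1 + 0) - s 0) @[h --> (0:R)^'] --> (0 : R).
  (* One half of [e] bounds the zero given by [near_root], the other half the slack [h ^+ 2]. *)
  apply/cvgrPdist_le => e e0; have e20 : 0 < e / 2 by rewrite divr_gt0.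
  have := near_root _ e20; rewrite !nearE => H.
  near=> h.
  have h0 : h != 0 by near: h; exact: nbhs_dnbhs_neq.
  rewrite sub0r normrN s00 subr0 addr0 [h *: 1]mulr1 normrM normfV.
  rewrite ler_pdivrMl ?normr_gt0//.
  have [_ Qh] : Q h (s h) by near: h; exact: nbhs_dnbhs.
  have [s' s'h Fs'] : exists2 s : R, `|s| <= e / 2 * `|h| &
      F (h *: X + s *: w + q) = 0.
    by near: h; exact: nbhs_dnbhs.
  have h2 : h ^+ 2 = `|h| * `|h| by rewrite -normrM -expr2 ger0_norm// sqr_ge0.
  rewrite (le_trans (Qh _ Fs'))// h2.
  have he : `|h| <= e / 2.
    by near: h; exact: dnbhs0_le.
  by rewrite [X in _ <= _ * X]splitr mulrDr lerD ?ler_wpM2l// mulrC.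
by apply: DeriveDef; [apply/cvg_ex; exists 0|exact: cvg_lim].
Unshelve. all: by end_near. Qed.

End SmoothCalculus.

(** * Determinants *)

Section Determinants.
Variable R : realType.

(** As [r] has no repetitions, the condition [j != i] omits exactly one factor. *)
Lemma is_derive_prod (V : normedModType R) (I : eqType) (r : seq I)
    (f : I -> V -> R) (df : I -> R) x v :
  uniq r -> (forall i, is_derive x v (f i) (df i)) ->
  is_derive x v (fun y => \prod_(i <- r) f i y)
    (\sum_(i <- r) df i * \prod_(j <- r | j != i) f j x).
Proof.
move=> + dfx; elim: r => [_|a r IHr /= /andP[ar ur]].
  have -> : (fun y => \prod_(i <- [::]) f i y) = cst 1.
    by apply/funext => y; rewrite big_nil.
  by rewrite big_nil; exact: is_derive_cst.
have -> : (fun y => \prod_(i <- a :: r) f i y) =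
    f a * (fun y => \prod_(i <- r) f i y).
  by apply/funext => y; rewrite big_cons.
apply: is_derive_eq; first exact: (is_deriveM (dfx a) (IHr ur)).
rewrite big_cons big_cons eqxx /= addrC; congr (_ + _).
  rewrite /GRing.scale/= mulrC; congr (_ * _).
  rewrite big_seq [RHS]big_seq_cond; apply: eq_bigl => j.
  by have [jr|] := boolP (j \in r); rewrite //=; apply/esym;
    apply: contraNneq ar => <-.
rewrite /GRing.scale/= big_distrr/= big_seq [RHS]big_seq;
  apply: eq_bigr => i ir.
rewrite big_cons ifT; first by rewrite mulrCA.
by apply: contraNneq ar => ->.
Qed.

(** Jacobi's formula. Differentiating the Leibniz expansion gives the sum over [i] of the
    determinants [\det (B i)] in which row [i] is replaced by its derivative; each is expanded along
    that row. *)
Lemma is_derive_det (V : normedModType R) n (A : V -> 'M[R]_n)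
    (dA : 'I_n -> 'I_n -> R) x v :
  (forall i j, is_derive x v (fun y => A y i j : R) (dA i j)) ->
  is_derive x v (fun y => \det (A y))
    (\sum_i \sum_j dA i j * cofactor (A x) i j).
Proof.
move=> dAx.
pose B i := \matrix_(k, l) if k == i then dA k l else A x k l.
have -> : \sum_i \sum_j dA i j * cofactor (A x) i j = \sum_i \det (B i).
  apply: eq_bigr => i _; rewrite (expand_det_row _ i); apply: eq_bigr => j _.
  rewrite mxE eqxx; congr (_ * _); rewrite /cofactor; congr (_ * \det _).
  by apply/matrixP => k l; rewrite !mxE eq_sym (negbTE (neq_lift _ _)).
have -> : \sum_i \det (B i) = \sum_(s : 'S_n) (-1) ^+ s *
    \sum_(i <- index_enum 'I_n) dA i (s i) *
      \prod_(j <- index_enum 'I_n | j != i) A x j (s j).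
  rewrite exchange_big /=; apply: eq_bigr => s _; rewrite big_distrr /=.
  apply: eq_bigr => i _; congr (_ * _); rewrite (bigD1 i)//= mxE eqxx.
  by congr (_ * _); apply: eq_bigr => j ji; rewrite mxE (negbTE ji).
have -> : (fun y => \det (A y)) = \sum_(s : 'S_n)
    ((-1) ^+ s : R) *: (fun y => \prod_(i <- index_enum 'I_n) A y i (s i)).
  by apply/funext => y; rewrite fct_sumE.
apply: (big_ind2 (fun f g => is_derive x v f g)) => [|f df g dg ? ?|s _].
- exact: is_derive_cst.
- exact: is_deriveD.
- apply: is_deriveZ; apply:
    (is_derive_prod (f := fun i y => A y i (s i))) => //.
  exact: index_enum_uniq.
Qed.

Lemma bracket_combination n (L : 'M[R]_n.+2) (s t : seq 'rV[R]_n.+2) :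
  (forall i : 'I_n.+2, t`_i = \sum_(j < n.+2) L i j *: s`_j) ->
  bracket t = \det L * bracket s.
Proof.
move=> ts; rewrite /bracket -det_mulmx; congr (\det _); apply/row_matrixP => i.
rewrite rowK row_mul mulmx_sum_row ts; apply: eq_bigr => j _.
by rewrite rowK mxE.
Qed.

(** Passing between the moving frame [X] and the fixed vectors [e], [w] is a triangular change of
    rows, whose only diagonal entry other than 1 is [c]. This evaluates the volume form on a frame
    of N through a constant. *)
Lemma bracket_change n (e X : n.-tuple 'rV[R]_n.+2) (w xi : 'rV[R]_n.+2)
    (a y : 'I_n -> R) c :
  (forall i, tnth X i = tnth e i - a i *: w) ->
  bracket (X ++ [:: \sum_i y i *: tnth X i + c *: w; xi]) =
  c * bracket (e ++ [:: w; xi]).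
Proof.
move=> Xe; pose ext (f : 'I_n -> R) (k : nat) := oapp f 0 (insub k).
have extE f (i : 'I_n) : ext f i = f i by rewrite /ext valK.
have nth_lt (s : n.-tuple 'rV[R]_n.+2) u v (i : 'I_n) :
    (s ++ [:: u; v])`_i = tnth s i.
  by rewrite nth_cat size_tuple ltn_ord (tnth_nth 0).
have nth_n (s : n.-tuple 'rV[R]_n.+2) u v : (s ++ [:: u; v])`_n = u.
  by rewrite nth_cat size_tuple ltnn subnn.
have nth_n1 (s : n.-tuple 'rV[R]_n.+2) u v : (s ++ [:: u; v])`_n.+1 = v.
  by rewrite nth_cat size_tuple ltnNge leqnSn/= subSnn.
(* Row indices split into those of the tuple, then [n] for the transversal vector and [n.+1] for
   [xi]. *)
have ordP (Q : nat -> Prop) : (forall i : 'I_n, Q i) -> Q n -> Q n.+1 ->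
    forall i, (i < n.+2)%N -> Q i.
  move=> Qlt Qn Qn1 i in2; have [il|] := ltnP i n;
    first exact: (Qlt (Ordinal il)).
  rewrite leq_eqVlt => /predU1P[<-//|ni].
  by have -> : i = n.+1 by apply/eqP; rewrite eqn_leq ni andbT -ltnS.
have comb (l : nat -> nat -> R) (s : n.-tuple 'rV[R]_n.+2) u v (i : 'I_n.+2) :
    \sum_(j < n.+2) (\matrix_(i < n.+2, j < n.+2) l i j) i j *:
      (s ++ [:: u; v])`_j =
    \sum_(j < n) l i j *: tnth s j + l i n *: u + l i n.+1 *: v.
  rewrite !big_ord_recr/= !mxE/= nth_n nth_n1; congr (_ + _ + _).
  by apply: eq_bigr => j _; rewrite mxE nth_lt.
(* [l1] and [l2] are triangular: the change of rows factors through the row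
   replacing [w] and the rows replacing [e]. *)
pose l1 i j : R :=
  if i == n then (if (j < n)%N then ext y j else (j == n)%:R * c)
  else (i == j)%:R.
pose l2 i j : R := (i == j)%:R - ((i < n)%N && (j == n))%:R * ext a i.
rewrite (@bracket_combination _ (\matrix_(i, j) l1 i j) (X ++ [:: w; xi]));
  last first.
  move=> i; rewrite comb; move: (nat_of_ord i) (ltn_ord i) => {i};
    apply: ordP => [i||].
  - rewrite nth_lt /l1 (ltn_eqF (ltn_ord i)) (ltn_eqF (leqW (ltn_ord i)))
    !scale0r !addr0.
    rewrite (bigD1 i)//= eqxx scale1r big1 ?addr0// => j ji.
    by rewrite (_ : _ == _ = false) ?scale0r//; apply/eqP => /val_inj ij;
      rewrite ij eqxx in ji.
  - rewrite nth_n /l1 eqxx ltnn mul1r ltnNge leqnSn/= (gtn_eqF (ltnSn n)) mul0r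
    scale0r addr0.
    by congr (_ + _); apply: eq_bigr => j _; rewrite ltn_ord extE.
  - rewrite nth_n1 /l1 (gtn_eqF (ltnSn n)) eqxx scale1r scale0r addr0.
    by rewrite big1 ?add0r// => j _;
      rewrite (gtn_eqF (leqW (ltn_ord j))) scale0r.
rewrite (@bracket_combination _ (\matrix_(i, j) l2 i j) (e ++ [:: w; xi]));
  last first.
  move=> i; rewrite comb; move: (nat_of_ord i) (ltn_ord i) => {i};
    apply: ordP => [i||].
  - rewrite nth_lt /l2 ltn_ord eqxx (ltn_eqF (ltn_ord i))
      (ltn_eqF (leqW (ltn_ord i)))/=.
    rewrite (gtn_eqF (ltnSn n))/= mul0r !subr0 sub0r mul1r scaleNr scale0r
      addr0 extE Xe.
    congr (_ - _); rewrite (bigD1 i)//= eqxx (ltn_eqF (ltn_ord i)) mul0r subr0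
      scale1r.
    rewrite big1 ?addr0// => j ji; rewrite (ltn_eqF (ltn_ord j)) mul0r subr0.
    by rewrite (_ : _ == _ = false) ?scale0r//; apply/eqP => /val_inj ij;
      rewrite ij eqxx in ji.
  - rewrite nth_n /l2 ltnn eqxx/= !mul0r (ltn_eqF (ltnSn n)) !subr0 scale1r
    scale0r addr0.
    by rewrite big1 ?add0r// => j _;
      rewrite subr0 (gtn_eqF (ltn_ord j)) scale0r.
  - rewrite nth_n1 /l2 ltnNge leqnSn/= (gtn_eqF (ltnSn n)) eqxx !mul0r !subr0
    scale0r scale1r addr0.
    by rewrite big1 ?add0r// => j _;
      rewrite subr0 (gtn_eqF (leqW (ltn_ord j))) scale0r.
rewrite mulrA; congr (_ * _).
(* [l1] is lower triangular with diagonal 1, ..., 1, [c], 1; [l2] is upper triangular with unit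
   diagonal, hence transposed first. *)
rewrite det_trig; last first.
  apply/is_trig_mxP => i j ij; rewrite mxE /l1 (ltn_eqF ij); case: eqP => // iE.
  have nj : (n < j)%N := leq_trans (eq_leq (congr1 S (esym iE))) ij.
  by rewrite ltnNge (ltnW nj)/= (gtn_eqF nj) mul0r.
rewrite -det_tr det_trig; last first.
  apply/is_trig_mxP => i j ij; rewrite !mxE /l2 (gtn_eqF ij) sub0r;
    case: eqP => iE; last by rewrite andbF mul0r oppr0.
  have nj : (n < j)%N := leq_trans (eq_leq (congr1 S (esym iE))) ij.
  by rewrite ltnNge (ltnW nj) mul0r oppr0.
rewrite [X in _ * X]big1 ?mulr1; last first.
  move=> i _; rewrite !mxE /l2 eqxx; case: eqP => iE;
    last by rewrite andbF mul0r subr0.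
  by rewrite iE ltnn mul0r subr0.
rewrite !big_ord_recr/= !mxE /l1/= eqxx ltnn mul1r (gtn_eqF (ltnSn n)) eqxx
  mulr1.
rewrite big1 ?mul1r// => i _; rewrite mxE/= (ltn_eqF (ltn_ord i)) eqxx//.
Qed.

End Determinants.

(** * The Hessian of a defining function *)

Section FiniteDimensionalCalculus.
Variables (R : realType) (m : nat).
Local Notation V := 'rV[R]_m.+1.

Lemma functional_continuous (l : {linear V -> R^o}) : continuous l.
Proof.
have -> : (l : V -> R^o) =
    \sum_(k < m.+1) (fun v : V => v 0 k *: l (delta_mx 0 k)).
  apply/funext => v; rewrite fct_sumE [in LHS](row_sum_delta v) linear_sum.
  by apply: eq_bigr => k _; rewrite linearZ.
move=> v; apply: differentiable_continuous.
apply: (@differentiable_sum R V R^o m.+1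
  (fun k (v : V) => v 0 k *: l (delta_mx 0 k))) => k.
by apply: differentiableZl; exact: differentiable_coord.
Qed.

Lemma derive_functional (l : {linear V -> R^o}) (Y : V -> V) q X :
  differentiable Y q ->
  differentiable (l \o Y) q /\ 'D_X (l \o Y) q = l ('D_X Y q).
Proof.
move=> dY; have dl : differentiable l (Y q).
  exact/linear_differentiable/functional_continuous.
have dlY : differentiable (l \o Y) q by exact: differentiable_comp.
split=> //; rewrite deriveE// diff_comp//= diff_lin ?deriveE//.
exact: functional_continuous.
Qed.

(** The forms are the coordinates of the complementary projection [1 - projv W]. They turn
    membership in [W] into scalar equations that can be differentiated. *)
Lemma vspace_functionals (W : {vspace V}) :
  exists l : 'I_m.+1 -> {linear V -> R^o},
  forall v, v \in W <-> forall j, l j v = 0.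
Proof.
pose pi := (\1 - projv W)%VF.
have pi_lin j : linear (fun v : V => pi v 0 j : R^o).
  by move=> a u v; rewrite linearP !mxE.
pose l j : {linear V -> R^o} := HB.pack (fun v : V => pi v 0 j : R^o)
  (GRing.isLinear.Build _ _ _ _ _ (pi_lin j)).
exists l => v; split=> [vW j|lv0].
  by rewrite /l/= /pi add_lfunE opp_lfunE id_lfunE projv_id// subrr mxE.
have : pi v = 0 by apply/rowP => j; rewrite mxE; exact: lv0.
by rewrite /pi add_lfunE opp_lfunE id_lfunE => /subr0_eq ->; exact: memv_proj.
Qed.

Lemma linear_combination (f : V -> R^o) (I : finType) (c : I -> R)
    (v : I -> V) :
  linear f -> f (\sum_i c i *: v i) = (\sum_i c i * (f (v i) : R) : R).
Proof.
move=> fl; pose l : {linear V -> R^o} :=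
  HB.pack f (GRing.isLinear.Build _ _ _ _ _ fl).
rewrite -[f]/(l : V -> R^o) linear_sum; apply: eq_bigr => i _.
by rewrite linearZ.
Qed.

Lemma linear_combination2 (f : V -> R^o) (a b : R) (u v : V) :
  linear f -> f (a *: u + b *: v) = a * (f u : R) + b * (f v : R) :> R.
Proof.
move=> fl; pose l : {linear V -> R^o} :=
  HB.pack f (GRing.isLinear.Build _ _ _ _ _ fl).
by rewrite -[f]/(l : V -> R^o) linearD !linearZ.
Qed.

Lemma linear_add (f : V -> R^o) (u v : V) :
  linear f -> f (u + v) = (f u : R) + (f v : R) :> R.
Proof.
by move=> fl; have := linear_combination2 1 1 u v fl; rewrite !scale1r !mul1r.
Qed.

Lemma linear_subZ (f : V -> R^o) (b : R) (u v : V) :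
  linear f -> f (u - b *: v) = (f u : R) - b * (f v : R) :> R.
Proof.
move=> fl; have := linear_combination2 1 (- b) u v fl.
by rewrite scale1r mul1r scaleNr mulNr.
Qed.

Variables (F : V -> R^o) (U : set V).
Hypotheses (oU : open U) (smF : forall k, Ck_on k U F).

Definition hessian q X Y : R := 'D_X ('D_Y F) q.

Lemma differentiable_F q : U q -> differentiable F q.
Proof. exact: (smF 1).1. Qed.

Lemma differentiable_DF v q : U q -> differentiable ('D_v F) q.
Proof. exact: ((smF 2).2 v).1. Qed.

Lemma differentiable_D2F u v q : U q -> differentiable ('D_u ('D_v F)) q.
Proof. exact: (((smF 3).2 v).2 u).1. Qed.

Lemma near_open q : U q -> \forall x \near q, U x.
Proof. by move=> Uq; exact: open_nbhs_nbhs. Qed.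

Lemma DF_linear q : U q -> linear (fun v => 'D_v F q : R^o).
Proof.
by move=> Uq a u v; rewrite !deriveE ?linearP//; exact: differentiable_F.
Qed.

Lemma DF_sum q (I : finType) (c : I -> R) (v : I -> V) : U q ->
  'D_(\sum_i c i *: v i) F q = \sum_i c i * ('D_(v i) F q : R) :> R.
Proof. by move=> Uq; exact: (linear_combination c v (DF_linear Uq)). Qed.

Lemma DF_comb2 q a b u v : U q ->
  'D_(a *: u + b *: v) F q = a * ('D_u F q : R) + b * ('D_v F q : R) :> R.
Proof. by move=> Uq; exact: (linear_combination2 a b u v (DF_linear Uq)). Qed.

Lemma DF_add q u v : U q ->
  'D_(u + v) F q = ('D_u F q : R) + ('D_v F q : R) :> R.
Proof. by move=> Uq; exact: (linear_add u v (DF_linear Uq)). Qed.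

Lemma DF_subZ q b u v : U q ->
  'D_(u - b *: v) F q = ('D_u F q : R) - b * ('D_v F q : R) :> R.
Proof. by move=> Uq; exact: (linear_subZ b u v (DF_linear Uq)). Qed.

Lemma DF_scale q a u : U q -> 'D_(a *: u) F q = a * ('D_u F q : R) :> R.
Proof.
move=> Uq; have := DF_subZ (- a) 0 u Uq.
by rewrite sub0r scaleNr opprK derive0 sub0r mulNr opprK.
Qed.

Lemma hessian_linear_l Y q : U q -> linear (fun X => hessian q X Y : R^o).
Proof.
by move=> Uq a u v; rewrite /hessian !deriveE ?linearP//;
  exact: differentiable_DF.
Qed.

Lemma hessian_linear_r X q : U q -> linear (fun Y => hessian q X Y : R^o).
Proof.
move=> Uq a u v; rewrite /hessian.
have du := @diff_derivable _ _ _ _ _ X (differentiable_DF u Uq).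
have dv := @diff_derivable _ _ _ _ _ X (differentiable_DF v Uq).
have /near_eq_derive -> : \forall x \near q,
    'D_(a *: u + v) F x = (a *: 'D_u F + 'D_v F) x.
  by apply: filterS (near_open Uq) => x Ux; rewrite (DF_linear Ux).
by have [_ ->] := is_deriveD (is_deriveZ a (derivableP du)) (derivableP dv).
Qed.

Lemma hessian_suml q (I : finType) (c : I -> R) (v : I -> V) Y : U q ->
  hessian q (\sum_i c i *: v i) Y = \sum_i c i * hessian q (v i) Y.
Proof.
by move=> Uq; exact: (linear_combination c v (hessian_linear_l Y Uq)).
Qed.

Lemma hessian_sumr q (I : finType) (c : I -> R) (v : I -> V) X : U q ->
  hessian q X (\sum_i c i *: v i) = \sum_i c i * hessian q X (v i).
Proof.
by move=> Uq; exact: (linear_combination c v (hessian_linear_r X Uq)).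
Qed.

Lemma hessian_comb2r q a b u v X : U q ->
  hessian q X (a *: u + b *: v) = a * hessian q X u + b * hessian q X v.
Proof.
by move=> Uq; exact: (linear_combination2 a b u v (hessian_linear_r X Uq)).
Qed.

Lemma hessian_addr q u v X : U q ->
  hessian q X (u + v) = hessian q X u + hessian q X v.
Proof. by move=> Uq; exact: (linear_add u v (hessian_linear_r X Uq)). Qed.

Lemma hessian_subZl q b u v Y : U q ->
  hessian q (u - b *: v) Y = hessian q u Y - b * hessian q v Y.
Proof. by move=> Uq; exact: (linear_subZ b u v (hessian_linear_l Y Uq)). Qed.

Lemma hessian_subZr q b u v X : U q ->
  hessian q X (u - b *: v) = hessian q X u - b * hessian q X v.
Proof. by move=> Uq; exact: (linear_subZ b u v (hessian_linear_r X Uq)). Qed.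

Lemma hessian_sym X Y q : U q -> hessian q X Y = hessian q Y X.
Proof.
move=> Uq; apply: schwarz; [|exact: differentiable_DF..].
by apply: filterS (near_open Uq) => x; exact: differentiable_F.
Qed.

(** Writing [Y] in coordinates makes dF(Y) a finite sum of products, to which the product rule
    applies. *)
Lemma derive_along (Y : V -> V) q X : U q -> differentiable Y q ->
  differentiable (fun x => 'D_(Y x) F x) q /\
  'D_X (fun x => 'D_(Y x) F x) q = hessian q X (Y q) + 'D_('D_X Y q) F q.
Proof.
move=> Uq dY.
pose G :=
  \sum_(k < m.+1) (fun x => Y x 0 k : R) * ('D_(delta_mx 0 k) F : V -> R).
have YG : \forall x \near q, G x = 'D_(Y x) F x.
  apply: filterS (near_open Uq) => x Ux; rewrite [in RHS](row_sum_delta (Y x)).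
  by rewrite DF_sum// /G fct_sumE.
have dYk k : differentiable (fun x => Y x 0 k : R) q.
  by apply: (@differentiable_comp _ _ _ _ Y (fun N : V => N 0 k : R)) => //;
    exact: differentiable_coord.
have dG : differentiable G q.
  by apply: differentiable_sum => k; apply: differentiableM => //;
    exact: differentiable_DF.
split; first exact: near_eq_differentiable dG.
rewrite -(near_eq_derive _ YG) /G derive_sum; last first.
  by move=> k; apply: derivableM; apply: diff_derivable => //;
    exact: differentiable_DF.
rewrite [Y q in RHS]row_sum_delta ['D_X Y q in RHS]row_sum_delta.
rewrite hessian_sumr// DF_sum// -big_split/=.
apply: eq_bigr => k _; rewrite deriveM; last 2 first.
- exact: diff_derivable.
- exact/diff_derivable/differentiable_DF.
congr (_ + _).
rewrite [LHS]mulrC; congr (_ * _).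
by rewrite derive_mx ?mxE//; exact: diff_derivable.
Qed.

End FiniteDimensionalCalculus.

(** * Sections of the hypersurface *)

Section TangentSpaces.
Variables (R : realType) (n : nat).
Local Notation V := 'rV[R]_n.+2.

(** Along a curve of [N] with velocity [X] the composite with [G] is constantly zero near time 0. *)
Lemma tangent_derive0 (N : set V) (W : normedModType R) (G : V -> W) q X :
  differentiable G q -> (\forall x \near q, N x -> G x = 0) ->
  tangent N q X -> 'D_X G q = 0.
Proof.
move=> dG GN [c [c0 cN dc]]; rewrite -c0 in dG GN *.
have [_ <-] := is_derive_curve dG dc.
have cc : {for (0 : R), continuous c}.
  by apply: differentiable_continuous; apply/derivable1_diffP.
have /near_eq_derive -> : \forall t \near (0 : R), (G \o c) t = cst 0 t.
  by have := cc _ GN; apply: filterS2 cN => t /= Nct; apply.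
exact: derive_cst.
Qed.

Variables (F : V -> R^o) (U N : set V) (W : {vspace V}) (p w : V).
Hypotheses (oU : open U) (smF : forall k, Ck_on k U F) (wW : w \in W).

(** Since [w] lies in [W], this says that near [q] the set [N] is the transversal intersection of
    the level set of [F] with the affine subspace p + W. The condition is open, so statements at [p]
    extend to nearby points. *)
Definition regular_at q := [/\ U q, 'D_w F q != 0 &
  \forall x \near q, N x <-> x - p \in W /\ F x = 0].

Lemma regular_near q : regular_at q -> \forall x \near q, regular_at x.
Proof.
move=> [Uq wq /nbhs_interior Nq].
have Dw : \forall x \near q, 'D_w F x != 0.
  have : {for q, continuous ('D_w F)}.
    exact/differentiable_continuous/(differentiable_DF smF).
  by move/cvgr_neq0; apply.
by apply: filterS3 (near_open oU Uq) Dw Nq => x.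
Qed.

(** One inclusion differentiates the equations of [N]. For the other, [zero_curve] corrects the line
    of direction [X] by multiples of [w]; the curve stays in p + W because [X] and [w] are in
    [W]. *)
Lemma tangentP q X : regular_at q -> N q ->
  tangent N q X <-> X \in W /\ 'D_X F q = 0.
Proof.
move=> [Uq wq NW] Nq; split=> [tX|[XW DX]].
  split.
    have [l lP] := vspace_functionals W; apply/lP => j.
    have dY : differentiable (fun x : V => x - p) q by [].
    have [dl lE] := derive_functional (l j) X dY.
    have DYX : 'D_X (fun x : V => x - p) q = X.
      by have [_ ->] := is_deriveB (is_derive_id q X) (is_derive_cst p q X);
        rewrite subr0.
    rewrite DYX in lE; rewrite -lE; apply: tangent_derive0 dl _ tX.
    by apply: filterS NW => x NWx /NWx[xW _]; exact: ((lP _).1 xW j).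
  apply: tangent_derive0 (differentiable_F smF Uq) _ tX.
  by apply: filterS NW => x NWx /NWx[].
have [qW Fq] := (nbhs_singleton NW).1 Nq.
have [|//|//|//|//|s [s0 ds Fs]] := @zero_curve R V F q X w.
  apply: filterS (near_open oU Uq) => x Ux.
  exact/differentiable_continuous/(differentiable_F smF).
  exact: (differentiable_F smF).
pose c t := (t *: X + q) + s t *: w.
have sd : differentiable s 0 by apply/derivable1_diffP.
have dsw : is_derive (0 : R) 1 (fun t => s t *: w) 0.
  have dsw : differentiable (fun t => s t *: w) 0 by exact: differentiableZl.
  apply: DeriveDef; first exact: diff_derivable.
  by rewrite deriveE// diffZl//= -deriveE// derive_val scale0r.
have dc : is_derive (0 : R) 1 c X.
  by apply: is_derive_eq (is_deriveD (is_derive_line X q 0) dsw) _;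
    rewrite addr0.
have c0 : c 0 = q by rewrite /c s0 !scale0r addr0 add0r.
exists c; split=> //.
have cc : {for (0 : R), continuous c}.
  by apply: differentiable_continuous; apply/derivable1_diffP.
have := cc; rewrite /prop_for /continuous_at c0 => /(_ _ NW).
apply: filterS2 Fs => t Ft NWt; apply/NWt; split; last by rewrite /c addrAC.
have -> : c t - p = t *: X + s t *: w + (q - p).
  by rewrite /c -!addrA (addrCA q).
by rewrite memvD// memvD ?memvZ.
Qed.

(** Along [N] the field satisfies the linear equations of [W] and dF(Y) = 0; both are differentiated
    in the direction [X]. *)
Lemma tangent_field_derive q X Y : regular_at q -> N q -> tangent N q X ->
  tangent_field N q Y ->
  [/\ tangent N q (Y q), 'D_X Y q \in W &
      hessian F q X (Y q) = - 'D_('D_X Y q) F q].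
Proof.
move=> rq Nq tX [[U' [oU' U'q smY]] tY].
have dY : differentiable Y q := (smY 1).1 q U'q.
have [Uq _ _] := rq.
have YT : \forall x \near q, N x -> Y x \in W /\ 'D_(Y x) F x = 0.
  by apply: filterS2 (regular_near rq) tY => x rx tYx Nx; exact/tangentP/tYx.
split; first exact: (nbhs_singleton tY).
  have [l lP] := vspace_functionals W; apply/lP => j.
  have [dl <-] := derive_functional (l j) X dY.
  apply: tangent_derive0 dl _ tX.
  by apply: filterS YT => x /[apply] -[YW _]; exact: ((lP _).1 YW j).
have [dG DG] := derive_along oU smF X Uq dY.
apply/eqP; rewrite -addr_eq0 -DG; apply/eqP; apply: tangent_derive0 dG _ tX.
by apply: filterS YT => x /[apply] -[].
Qed.

(** The forms [h] are tested on tangent fields only, so vectors must be extended. The combination of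
    [Y] and [w] with coefficients dF(w) and -dF(Y) lies in [W] and in the kernel of dF at every
    point. *)
Lemma tangent_extension q Y : regular_at q -> N q -> tangent N q Y ->
  exists2 Z, tangent_field N q Z & Z q = Y.
Proof.
move=> rq Nq /(tangentP _ rq Nq)[YW DY]; have [Uq wq _] := rq.
pose d := 'D_w F q : R.
(* The division is by the constant [d], so this field is smooth without any
   quotient rule. *)
exists (fun x => 'D_w F x *: (d^-1 *: Y) - 'D_Y F x *: (d^-1 *: w)); last first.
  by rewrite DY scale0r subr0 scalerA mulfV// scale1r.
split.
  exists U; split=> // k.
  by apply: Ck_on_scalel_sub => //; [exact: (smF k.+1).2|exact: (smF k.+1).2].
apply: filterS (regular_near rq) => x rx Nx; apply/tangentP => //; split.
  by rewrite rpredB ?rpredZ.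
have [Ux _ _] := rx.
rewrite !scalerA -scaleNr (DF_comb2 smF)// mulNr.
by apply/eqP; rewrite subr_eq0 mulrAC [eqbRHS]mulrAC [X in X * _ == _]mulrC.
Qed.

Lemma affine_form q (eta : V) (h : V -> V -> R) : regular_at q -> N q ->
  (forall X Y, tangent N q X -> tangent_field N q Y ->
     'D_('D_X Y q - h X (Y q) *: eta) F q = 0) ->
  forall X Y, tangent N q X -> tangent N q Y ->
  hessian F q X Y = - (h X Y * 'D_eta F q).
Proof.
move=> rq Nq hP X Y tX /(tangent_extension rq Nq)[Z tZ <-].
have [Uq _ _] := rq.
have [_ _ ->] := tangent_field_derive rq Nq tX tZ; congr (- _).
have := hP X Z tX tZ; rewrite -scaleNr -[X in X + _]scale1r (DF_comb2 smF)//.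
by rewrite mul1r mulNr => /subr0_eq.
Qed.

End TangentSpaces.

Lemma dim_rV (R : realType) n : \dim {:'rV[R]_n} = n.
Proof. by rewrite dimvf dim_matrix mul1r. Qed.

(** * Sections by admissible hyperplanes and their non-degeneracy *)

Section AdmissibleSections.
Variables (R : realType) (n : nat).
Local Notation V := 'rV[R]_n.+2.
Variables (M : set V) (p : V) (F : V -> R^o) (U : set V).
Variables (T : {vspace V}) (v : V).
Hypotheses (oU : open U) (Up : U p) (smF : forall k, Ck_on k U F).
Hypotheses (Mp : M p) (MF : \forall q \near p, M q <-> F q = 0).
Hypotheses (dimT : \dim T = n) (TM : [set` T] `<=` tangent M p).
Hypothesis (Dv : 'D_v F p != 0).

Lemma tangent_hypersurface X : tangent M p X <-> 'D_X F p = 0.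
Proof.
(* M is regarded as its own section by the whole space, so [tangentP] applies with [W] replaced by
   [fullv]. *)
have rp : regular_at F U M fullv p v p.
  split=> //; apply: filterS MF => q MFq; split=> [/MFq|[_ /MFq]//].
  by split=> //; exact: memvf.
split=> [/(tangentP oU smF (memvf v) _ rp Mp)[]//|DX].
by apply/(tangentP oU smF (memvf v) _ rp Mp); split=> //; exact: memvf.
Qed.

Lemma T_sub_ker X : X \in T -> 'D_X F p = 0.
Proof. by move=> XT; apply/tangent_hypersurface/TM. Qed.

Lemma DF_kernel : exists2 K : {vspace V}, \dim K = n.+1 &
  forall X, X \in K <-> 'D_X F p = 0.
Proof.
pose l : {linear V -> R^o} := HB.pack (fun v => 'D_v F p : R^o)
  (GRing.isLinear.Build _ _ _ _ _ (DF_linear smF Up)).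
have KP X : X \in lker (linfun l) <-> 'D_X F p = 0.
  by rewrite memv_ker lfunE; split=> /eqP.
exists (lker (linfun l)) => //; apply/eqP; rewrite eqn_leq; apply/andP; split.
  rewrite -ltnS; rewrite -[X in (_ < X)%N](@dim_rV R).
  rewrite ltn_neqAle dimvS ?subvf// andbT; apply: contraNneq Dv => dK.
  apply/eqP/KP; have /eqP -> : lker (linfun l) == fullv.
    by rewrite eqEdim subvf dK/=.
  exact: memvf.
have := limg_ker_dim (linfun l) fullv; rewrite capfv dim_rV => dK.
have : (\dim (limg (linfun l)) <= 1)%N.
  by rewrite (leq_trans (dimvS (subvf _)))// dimvf.
by rewrite -(leq_add2l (\dim (lker (linfun l)))) dK addn1 ltnS.
Qed.

(** [H] and the kernel of dF have the same dimension and differ, so [H] is not contained in that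
    kernel. *)
Lemma admissible_transversal H : admissible M p T H ->
  exists2 w, w \in H & 'D_w F p != 0.
Proof.
move=> [dH TH HM]; have [K dK KP] := DF_kernel.
have /subvPn[w wH wK] : ~~ (H <= K)%VS.
  apply/negP => HK; apply: HM.
  have /eqP HK' : H == K by rewrite eqEdim HK dK dH/=.
  by apply/seteqP; split=> X /=; rewrite HK';
    [move/KP/tangent_hypersurface|move/tangent_hypersurface/KP].
exists w; first exact: wH.
by apply: contraNN wK => /eqP/KP.
Qed.

(** [T] lies in the intersection of [H] with the kernel of dF, a proper subspace of [H] and hence of
    dimension at most [n]. *)
Lemma admissibleP H X : admissible M p T H ->
  X \in T <-> X \in H /\ 'D_X F p = 0.
Proof.
move=> aH; have [w wH Dw] := admissible_transversal aH.
have [dH TH _] := aH; have [K dK KP] := DF_kernel.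
have -> : T = (H :&: K)%VS.
  apply/eqP; rewrite eqEdim; apply/andP; split.
    rewrite subv_cap TH/=; apply/subvP => Y YT; exact/KP/T_sub_ker.
  rewrite dimT -ltnS -[X in (_ < X)%N]dH ltn_neqAle dimvS ?capvSl// andbT.
  apply: contraNneq Dw => dHK; apply/eqP/KP.
  have /eqP HK : (H :&: K == H)%VS by rewrite eqEdim capvSl dHK/=.
  by move: wH; rewrite -HK memv_cap => /andP[].
by rewrite memv_cap; split=> [/andP[? /KP]|[-> /KP ->]].
Qed.

Lemma section_regular H w : 'D_w F p != 0 ->
  regular_at F U (section M p H) H p w p.
Proof.
move=> Dw; split=> //; apply: filterS MF => q MFq.
by split=> [[/MFq]|[? /MFq]].
Qed.

Lemma section_base H : section M p H p.
Proof. by split=> //; rewrite /hyperplane_through/= subrr mem0v. Qed.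

Lemma tangent_section H X : admissible M p T H ->
  tangent (section M p H) p X <-> X \in T.
Proof.
move=> aH; have [w wH Dw] := admissible_transversal aH.
apply: iff_trans (iff_sym (admissibleP X aH)).
exact: (tangentP oU smF wH _ (section_regular H Dw) (section_base H)).
Qed.

Lemma nondegenerate_hessian H : admissible M p T H ->
  nondegenerate_at M (section M p H) p ->
  forall X, X \in T -> (forall Y, Y \in T -> hessian F p X Y = 0) -> X = 0.
Proof.
move=> aH [xi [eta [h1 [h2 [[/tangent_hypersurface Dxi _] Meta hP nd]]]]] X XT
  XY.
have [w wH Dw] := admissible_transversal aH.
apply: nd => [|Y /(tangent_section _ aH) YT]; first exact/tangent_section.
have De : 'D_eta F p != 0 by apply/eqP => /tangent_hypersurface.
have : hessian F p X Y = - (h2 X Y * 'D_eta F p).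
  apply: (affine_form oU smF wH (section_regular H Dw) (section_base H)).
  - move=> A B tA tB; have /(tangent_section _ aH)/T_sub_ker := hP A B tA tB.
    move: ('D_A B p) => Z E0.
    have := DF_comb2 smF 1 (h1 A (B p))
      (Z - h1 A (B p) *: xi - h2 A (B p) *: eta) xi Up.
    rewrite E0 Dxi !mulr0 addr0 scale1r => <-; congr ('D_(_) F p).
    by rewrite addrAC subrK.
  - exact/tangent_section.
  - exact/tangent_section.
by rewrite XY// => /esym/eqP; rewrite oppr_eq0 mulf_eq0 (negbTE De) orbF
  => /eqP.
Qed.

Lemma hessian_nondegenerate H : admissible M p T H ->
  (forall X, X \in T -> (forall Y, Y \in T -> hessian F p X Y = 0) -> X = 0) ->
  nondegenerate_at M (section M p H) p.
Proof.
move=> aH nd; have [w wH Dw] := admissible_transversal aH.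
have [K dK KP] := DF_kernel.
have /subvPn[xi xiK xiT] : ~~ (K <= T)%VS.
  by apply/negP => /dimvS; rewrite dK dimT ltnn.
(* With the transversal [w] chosen inside [H], derivatives of tangent fields stay in [H] and have no
   [xi] component, so [h1] is zero. *)
exists xi, w, (fun _ _ => 0), (fun X Y => - (hessian F p X Y / 'D_w F p)).
split.
- split; first exact/tangent_hypersurface/KP.
  by move=> /(tangent_section _ aH); apply/negP.
- by move=> /tangent_hypersurface Dw0; rewrite Dw0 eqxx in Dw.
- move=> X Y tX tY.
  have [_ YW ->] := tangent_field_derive oU smF wH (section_regular H Dw)
    (section_base H) tX tY.
  apply/(tangent_section _ aH)/(admissibleP _ aH);
    rewrite scale0r subr0 mulNr opprK.
  split; first by rewrite memvB// memvZ.
  rewrite -scaleNr -[X in X + _]scale1r (DF_comb2 smF)//.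
  by rewrite mul1r mulNr divfK// subrr.
- move=> X /(tangent_section _ aH) XT XY; apply: nd => // Y YT.
  have /eqP := XY Y ((tangent_section _ aH).2 YT).
  by rewrite oppr_eq0 mulf_eq0 invr_eq0 (negbTE Dw) orbF => /eqP.
Qed.

End AdmissibleSections.

(** * The plane of affine normals *)

Section NormalPlane.
Variables (R : realType) (n : nat).
Local Notation V := 'rV[R]_n.+2.
Variables (M : set V) (p : V) (F : V -> R^o) (U : set V).
Variables (T : {vspace V}) (v : V).
Hypotheses (oU : open U) (Up : U p) (smF : forall k, Ck_on k U F).
Hypotheses (Mp : M p) (MF : \forall q \near p, M q <-> F q = 0).
Hypotheses (dimT : \dim T = n) (TM : [set` T] `<=` tangent M p).
Hypothesis (Dv : 'D_v F p != 0).
Variable e : n.-tuple V.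
Hypothesis eT : basis_of T e.
Hypothesis nd : forall X, X \in T ->
  (forall Y, Y \in T -> hessian F p X Y = 0) -> X = 0.

Let DT := T_sub_ker oU Up smF Mp MF TM Dv.
Let admissibleE := admissibleP oU Up smF Mp MF dimT TM Dv.
Let tangentE := tangent_section oU Up smF Mp MF dimT TM Dv.

Let B := \matrix_(i < n, j < n) hessian F p (tnth e i) (tnth e j).
(** By Jacobi's formula, the derivative along e_k of det(D^2 F(e_i, e_j)) at [p]. *)
Let tau k := \sum_i \sum_j
  'D_(tnth e k) ('D_(tnth e i) ('D_(tnth e j) F)) p * cofactor B i j : R.

Lemma mem_e i : tnth e i \in T.
Proof. by rewrite (basis_mem eT)// mem_tnth. Qed.

Lemma comb_e X : X \in T -> exists c : 'I_n -> R, X = \sum_i c i *: tnth e i.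
Proof.
move=> XT; exists (fun i => coord e i X); rewrite [LHS](coord_basis eT XT).
by apply: eq_bigr => i _; rewrite (tnth_nth 0).
Qed.

Lemma comb_mem (c : 'I_n -> R) : \sum_i c i *: tnth e i \in T.
Proof. by apply: memv_suml => i _; rewrite memvZ// mem_e. Qed.

Lemma hessian_det_neq0 : \det B != 0.
Proof.
apply/det0P => -[c c0 cB]; pose X := \sum_i c 0 i *: tnth e i.
have X0 : X = 0.
  apply: nd => [|Y /comb_e[y ->]]; first exact: comb_mem.
  rewrite (hessian_sumr oU smF)// big1// => j _.
  have : (c *m B) 0 j = 0 by rewrite cB mxE.
  rewrite mxE (hessian_suml smF)// => cBj.
  rewrite [X in _ * X](_ : _ = 0) ?mulr0// -[RHS]cBj.
  by apply: eq_bigr => i _; rewrite mxE.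
case/eqP: c0; apply/rowP => i; rewrite mxE.
have /freeP := basis_free eT; apply => //; rewrite -[RHS]X0.
by apply: eq_bigr => j _; rewrite (tnth_nth 0).
Qed.

(** On [T] the terms with dF vanish and the system has the invertible matrix (n+2) det(B) B. The map
    [phi] is therefore onto, and its kernel has dimension (n+2) - n. *)
Lemma normal_plane : exists2 P : {vspace V}, \dim P = 2%N &
  forall u, (forall k, n.+2%:R * hessian F p (tnth e k) u * \det B =
                       ('D_u F p : R) * tau k) -> u \in P.
Proof.
pose phi (u : V) : 'rV[R]_n :=
  \row_k (n.+2%:R * hessian F p (tnth e k) u * \det B -
                       ('D_u F p : R) * tau k).
have phi_lin : linear phi.
  move=> a x y; apply/rowP => k; rewrite !mxE.
  have hE := hessian_comb2r oU smF a 1 x y (tnth e k) Up.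
  have DE := DF_comb2 smF a 1 x y Up.
  rewrite scale1r in hE DE; rewrite hE DE.
  have alg (A h1 h2 d D1 D2 t : R) :
    A * (a * h1 + 1 * h2) * d - (a * D1 + 1 * D2) * t
      = a * (A * h1 * d - D1 * t) + (A * h2 * d - D2 * t) by ring.
  exact: alg.
pose l : {linear V -> 'rV[R]_n} := HB.pack phi
  (GRing.isLinear.Build _ _ _ _ _ phi_lin).
exists (lker (linfun l)) => [|u uP]; last first.
  rewrite memv_ker lfunE/=; apply/eqP/rowP => k; rewrite !mxE; apply/eqP.
  by rewrite subr_eq0; apply/eqP.
suff lT : limg (linfun l) = fullv.
  have := limg_ker_dim (linfun l) fullv.
  by rewrite capfv lT !dim_rV => kn; apply: (@addIn n); rewrite kn.
apply/eqP; rewrite eqEsubv subvf/=; apply/subvP => r _.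
have nB : n.+2%:R * \det B != 0 :> R by rewrite mulf_neq0 ?hessian_det_neq0//
  pnatr_eq0.
pose c : 'cV[R]_n := (n.+2%:R * \det B)^-1 *: (invmx B *m r^T).
have -> : r = linfun l (\sum_i c i 0 *: tnth e i).
  rewrite lfunE/=; apply/rowP => k; rewrite mxE.
  have -> : 'D_(\sum_i c i 0 *: tnth e i) F p = 0.
    by apply: DT; exact: comb_mem.
  rewrite mul0r subr0 (hessian_sumr oU smF)//.
  have -> : \sum_i c i 0 * hessian F p (tnth e k) (tnth e i) = (B *m c) k 0.
    by rewrite mxE; apply: eq_bigr => i _; rewrite [in RHS]mulrC;
      congr (_ * _); rewrite mxE.
  rewrite -scalemxAr mulmxA mulmxV ?mul1mx;
    last by rewrite unitmxE unitfE hessian_det_neq0.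
  by rewrite !mxE mulrAC mulrA mulfV ?mul1r.
by rewrite memv_img ?memvf.
Qed.

Lemma derive_mul0 (f g : V -> R) q X :
  differentiable f q -> differentiable g q ->
  f q = 0 -> g q = 0 -> differentiable (f * g) q /\ 'D_X (f * g) q = 0.
Proof.
move=> df dg f0 g0; split; first exact: differentiableM.
by rewrite deriveM ?f0 ?g0 ?scale0r ?addr0//; exact: diff_derivable.
Qed.

(** Dividing the differentiated identity by the identity itself gives 2 D1/D0 = 2(m+1) g1/g; the
    cross-multiplied form avoids inverting [g]. The factor [d] is treated as constant. *)
Lemma log_derivative_eq m (b D0 D1 d g g1 : R) : D0 != 0 -> d != 0 ->
  D0 ^+ 2 * d ^+ 4 = b * g ^+ m.+1.*2 ->
  d ^+ 4 * (2 * D0 * D1) = b * (m.+1.*2%:R * g ^+ (m.+1.*2).-1 * g1) ->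
  m.+1%:R * g1 * D0 = g * D1.
Proof.
move=> D00 d0 E E1; apply: (@mulfI _ (2 * D0 * d ^+ 4)).
  by rewrite !mulf_neq0 ?expf_neq0// pnatr_eq0.
have -> : 2 * D0 * d ^+ 4 * (g * D1) = g * (d ^+ 4 * (2 * D0 * D1)) by ring.
rewrite E1 -muln2 natrM.
have -> : g * (b * (m.+1%:R * 2 * g ^+ (m.+1 * 2).-1 * g1)) =
  2 * m.+1%:R * g1 * (b * (g * g ^+ (m.+1 * 2).-1)) by ring.
rewrite -exprS prednK ?muln_gt0// muln2 -E; ring.
Qed.

(** * The Blaschke field of a single section *)

Section OneSection.
Variables (H : {vspace V}) (xi0 : V) (eta : V -> V).
Hypothesis (aH : admissible M p T H).
Hypothesis (bl : blaschke_field (section M p H) H xi0 p eta).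
Local Notation N := (section M p H).

(* Adding to a transversal vector a suitable element of T makes it
   Hessian-orthogonal to T, which removes the cross terms from the derivative
   of the volume identity below. *)
Lemma conjugate_transversal : exists w, [/\ w \in H, 'D_w F p != 0 &
  forall i, hessian F p (tnth e i) w = 0].
Proof.
have [w0 w0H Dw0] := admissible_transversal oU Up smF Mp MF Dv aH.
pose b := \col_i hessian F p (tnth e i) w0.
pose c := - (invmx B *m b).
exists (w0 + \sum_i c i 0 *: tnth e i).
have cT := comb_mem (fun i => c i 0).
have [TH _] := (admissibleE _ aH).1 cT.
have DcT := DT cT.
split; first by rewrite memvD.
  by rewrite (DF_add smF)// DcT addr0.
move=> i; rewrite (hessian_addr oU smF)//.
rewrite (hessian_sumr oU smF)//.
have -> : \sum_j c j 0 * hessian F p (tnth e i) (tnth e j) = (B *m c) i 0.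
  by rewrite mxE; apply: eq_bigr => j _; rewrite [in RHS]mulrC; congr (_ * _);
    rewrite mxE.
rewrite mulmxN mulmxA mulmxV ?mul1mx;
  last by rewrite unitmxE unitfE hessian_det_neq0.
by rewrite !mxE subrr.
Qed.

Variable w : V.
Hypotheses (wH : w \in H) (Dw : 'D_w F p != 0).
Hypothesis (ew : forall i, hessian F p (tnth e i) w = 0).

Let a i x : R := 'D_(tnth e i) F x / 'D_w F x.
Let frame x := [tuple tnth e i - a i x *: w | i < n].
Let G x := \matrix_(i < n, j < n)
  hessian F x (tnth (frame x) i) (tnth (frame x) j).
Let g x : R := 'D_(eta x) F x.

Lemma frame_tangent x i : regular_at F U N H p w x -> N x ->
  tangent N x (tnth (frame x) i).
Proof.
move=> rx Nx; apply/(tangentP oU smF wH _ rx Nx); rewrite tnth_mktuple.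
have [Ux wx _] := rx; split.
  rewrite memvB ?memvZ//; have [_ TH _] := aH.
  by rewrite (subvP TH)// mem_e.
rewrite (DF_subZ smF)// divfK//.
by rewrite subrr.
Qed.

(** Squaring the volume condition removes the absolute value. The matrix [G] is [- g] times that of
    [h], contributing g^(2n) to the squared determinant, and the bracket is g/dF(w) times the
    constant one, contributing the fourth power of that quotient. *)
Lemma volume_identity : \forall x \near p, N x ->
  (\det (G x)) ^+ 2 * ('D_w F x : R) ^+ 4 =
  bracket (e ++ [:: w; xi0]) ^+ 4 * g x ^+ n.+2.*2.
Proof.
have rp := section_regular Up MF H Dw; have [_ blp] := bl.
apply: filterS2 (regular_near oU smF rp) blp => x rx blx Nx.
have [[eH et] _ [h [hP vol]]] := blx Nx.
have [Ux wx _] := rx.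
have tf i := frame_tangent i rx Nx.
have Gh : G x = (- g x) *:
    \matrix_(i, j) h (tnth (frame x) i) (tnth (frame x) j).
  apply/matrixP => i j; rewrite !mxE.
  rewrite (affine_form oU smF wH rx Nx (eta := eta x) (h := h))//.
    by rewrite mulrC mulNr.
  by move=> X Y tX tY; have /(tangentP oU smF wH _ rx Nx)[] := hP X Y tX tY.
(* The derivatives are taken at [p], not at [x]: [eta x] is first decomposed along the fixed
   splitting of [H] into [T] and the line of [w], and then rewritten in the frame at [x]. *)
pose b : R := 'D_(eta x) F p / 'D_w F p.
have [y yE] : exists y : 'I_n -> R, eta x - b *: w = \sum_i y i *: tnth e i.
  apply: comb_e; apply/(admissibleE _ aH).
  split; first by rewrite memvB// memvZ.
  by rewrite (DF_subZ smF)// divfK// subrr.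
pose c := b + \sum_i y i * a i x.
have etaE : eta x = \sum_i y i *: tnth (frame x) i + c *: w.
  rewrite -[LHS](subrK (b *: w)) yE /c scalerDl scaler_suml [b *: w + _]addrC
    addrA.
  congr (_ + _); rewrite -big_split/=; apply: eq_bigr => i _.
  by rewrite tnth_mktuple scalerBr scalerA subrK.
have gE : g x = c * ('D_w F x : R).
  rewrite /g etaE (DF_add smF _ _ Ux) (DF_sum smF _ _ Ux) (DF_scale smF _ _ Ux).
  rewrite big1 ?add0r// => i _.
  by have /(tangentP oU smF wH _ rx Nx)[_ ->] := tf i; rewrite mulr0.
have := vol (frame x) tf.
rewrite etaE (@bracket_change _ _ e (frame x) w xi0 (fun i => a i x));
  last first.
  by move=> i; rewrite tnth_mktuple.
move/(congr1 (fun z => z ^+ 2)); rewrite -normrX ger0_norm ?sqr_ge0// => volE.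
rewrite Gh detZ exprMn -exprM volE -[n.+2.*2]addnn.
have -> : (- g x) ^+ (n * 2) = g x ^+ (n + n).
  by rewrite muln2 addnn -mul2n exprM sqrrN -exprM.
rewrite (_ : n.+2 + n.+2 = (n + n) + 4)%N; last by lia.
have g4 : g x ^+ 4 = c ^+ 4 * ('D_w F x : R) ^+ 4 by rewrite gE exprMn.
rewrite (exprD _ (n + n)%N 4) g4; ring.
Qed.

Lemma affine_normal_eq k :
  n.+2%:R * hessian F p (tnth e k) (eta p) * \det B =
  ('D_(eta p) F p : R) * tau k.
Proof.
have rp := section_regular Up MF H Dw.
have Np : N p := section_base Mp H.
have [[U' [oU' U'p smE]] blp] := bl.
have [_ etaT _] := nbhs_singleton blp Np.
have tk : tangent N p (tnth e k).
  by apply/(tangentE _ aH); exact: mem_e.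
have De i : 'D_(tnth e i) F p = 0.
  by apply: DT; exact: mem_e.
have a0 i : a i p = 0 by rewrite /a De mul0r.
have da i : differentiable (a i) p.
  apply: differentiableM; first exact: (differentiable_DF smF).
  by apply: differentiableV => //; exact: (differentiable_DF smF).
have [dg Dg] := derive_along oU smF (tnth e k) Up ((smE 1).1 p U'p).
(* Equiaffinity enters here: the derivative of [eta] along e_k is tangent to N, so dF kills it. *)
have {}Dg : 'D_(tnth e k) g p = hessian F p (tnth e k) (eta p).
  rewrite [LHS]Dg.
  have /(tangentE _ aH) etT := etaT _ tk.
  by rewrite (DT etT) addr0.
(* [K] is [G] expanded near p; each term of [K] other than [E] is a product of
   two functions vanishing at p, hence has derivative 0 there. *)
pose E i j : V -> R := 'D_(tnth e i) ('D_(tnth e j) F).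
pose L i : V -> R := 'D_w ('D_(tnth e i) F).
pose L' i : V -> R := 'D_(tnth e i) ('D_w F).
pose Q : V -> R := 'D_w ('D_w F).
pose K i j : V -> R := E i j - a i * L j - a j * L' i + a i * (a j * Q).
have KG i j : \forall x \near p, K i j x = G x i j.
  apply: filterS (near_open oU Up) => x Ux; rewrite mxE !tnth_mktuple.
  rewrite (hessian_subZl smF (a i x) (tnth e i) w _ Ux).
  rewrite (hessian_subZr oU smF (a j x) (tnth e j) w (tnth e i) Ux).
  rewrite (hessian_subZr oU smF (a j x) (tnth e j) w w Ux).
  have alg (e1 l1 l2 q1 ai aj : R) : e1 - ai * l1 - aj * l2 + ai * (aj * q1) =
    e1 - aj * l2 - ai * (l1 - aj * q1) by ring.
  exact: alg.
have D2 u z : differentiable ('D_u ('D_z F)) p := differentiable_D2F smF u z Up.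
have dK i j : differentiable (K i j) p /\
    'D_(tnth e k) (K i j) p = 'D_(tnth e k) (E i j) p.
  have L0 j' : L j' p = 0 by
    exact: etrans (hessian_sym oU smF w (tnth e j') Up) (ew j').
  have L'0 j' : L' j' p = 0 by exact: ew.
  have [dA DA] := derive_mul0 (tnth e k) (da i) (D2 _ _) (a0 i) (L0 j).
  have [dB DB] := derive_mul0 (tnth e k) (da j) (D2 _ _) (a0 j) (L'0 i).
  have aQ0 : (a j * Q) p = 0 := etrans (congr1 ( *%R^~ (Q p)) (a0 j)) (mul0r _).
  have daQ : differentiable (a j * Q) p := differentiableM (da j) (D2 w w).
  have [dC DC] := derive_mul0 (tnth e k) (da i) daQ (a0 i) aQ0.
  have dE : differentiable (E i j) p := D2 _ _.
  have dEA := differentiableB dE dA.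
  have dEAB := differentiableB dEA dB.
  have [_ DK] := is_deriveD (is_deriveB (is_deriveB
    (derivableP (@diff_derivable _ _ _ _ _ (tnth e k) dE))
    (derivableP (@diff_derivable _ _ _ _ _ (tnth e k) dA)))
    (derivableP (@diff_derivable _ _ _ _ _ (tnth e k) dB)))
    (derivableP (@diff_derivable _ _ _ _ _ (tnth e k) dC)).
  split; first exact: (differentiableD dEAB dC).
  have alg (x y z t : R) : y = 0 -> z = 0 -> t = 0 -> x - y - z + t = x.
    by move=> -> -> ->; rewrite !subr0 addr0.
  exact: etrans DK (alg _ _ _ _ DA DB DC).
have GB : G p = B.
  have frameE i : tnth (frame p) i = tnth e i.
    by rewrite tnth_mktuple a0 scale0r subr0.
  apply/matrixP => i j; rewrite [LHS]mxE [RHS]mxE.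
  exact: congr2 (frameE i) (frameE j).
(* The volume identity holds on N only, so it is differentiated along a curve of N with velocity
   e_k. *)
have [c [c0 cN dc]] := tk.
have cc : {for (0 : R), continuous c}.
  by apply: differentiable_continuous; apply/derivable1_diffP.
have curve (f : V -> R) : differentiable f p ->
    is_derive (0 : R) 1 (f \o c) ('D_(tnth e k) f p).
  move=> df; have dfc : differentiable f (c 0) by rewrite c0; exact: df.
  by have := is_derive_curve dfc dc; rewrite [in 'D_(_) f _]c0; exact.
have near_c (P : set V) :
    (\forall x \near p, P x) -> \forall t \near (0 : R), P (c t).
  by move=> Pp; apply: cc; rewrite c0.
have dG i j :
    is_derive (0 : R) 1 (fun t => G (c t) i j) ('D_(tnth e k) (E i j) p).
  have [dKp <-] := dK i j; apply: near_eq_is_derive (curve _ dKp).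
  exact: near_c (KG i j).
have ddet : is_derive (0 : R) 1 (fun t => \det (G (c t))) (tau k).
  by have := is_derive_det dG; rewrite c0 GB; exact.
have dd := curve _ (differentiable_DF smF w Up).
have dgc := curve _ dg; rewrite Dg in dgc.
(* By the choice of [w], dF(w) has zero derivative along this curve. *)
rewrite -/(hessian F p _ w) ew in dd.
pose beta := bracket (e ++ [:: w; xi0]) ^+ 4.
have dphi := is_deriveB (is_deriveM (is_deriveX 2 ddet) (is_deriveX 4 dd))
  (is_deriveZ beta (is_deriveX n.+2.*2 dgc)).
have phi0 := near_c _ volume_identity.
(* Here m = n+1, so that the exponent is 2(n+2). *)
apply: (@log_derivative_eq n.+1 beta _ _ ('D_w F p)).
- exact: hessian_det_neq0.
- exact: Dw.
- by rewrite -GB; exact: (nbhs_singleton volume_identity Np).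
have : 'D_1 (cst (0 : R)) (0 : R) = 0 := derive_cst _ _ _.
have /near_eq_derive <- : \forall t \near (0 : R),
    ((fun t => \det (G (c t))) ^+ 2 * (('D_w F : V -> R) \o c) ^+ 4 -
     beta *: ((g \o c) ^+ n.+2.*2)) t = cst 0 t.
  apply: filterS2 phi0 cN => t + Nt => /(_ Nt) volt.
  by rewrite /GRing.add/= /GRing.opp/= /GRing.mul/= !fctE/= volt subrr.
case: dphi => _ ->; rewrite !fctE/= c0 GB.
move=> /subr0_eq; rewrite !scaler0 add0r => E1; exact: E1.
Qed.

End OneSection.

End NormalPlane.

Theorem theorem6p2 (R : realType) (n : nat) (M : set 'rV[R]_n.+2)
    (p0 : 'rV[R]_n.+2) (T : {vspace 'rV[R]_n.+2})
    (hM : hypersurface_near M p0)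
    (dimT : \dim T = n)
    (TM : [set` T] `<=` tangent M p0)
    (H0 : {vspace 'rV[R]_n.+2})
    (H0_adm : admissible M p0 T H0)
    (H0_nondeg : nondegenerate_at M (section M p0 H0) p0) :
  (forall H : {vspace 'rV[R]_n.+2}, admissible M p0 T H ->
     nondegenerate_at M (section M p0 H) p0) /\
  exists P : {vspace 'rV[R]_n.+2},
    \dim P = 2%N /\
    forall H : {vspace 'rV[R]_n.+2}, admissible M p0 T H ->
      forall v : 'rV[R]_n.+2, affine_normal M p0 H v -> v \in P.
Proof.
have [Mp [F [[U [oU Up smF]] [v Dv] MF]]] := hM.
have nd := nondegenerate_hessian oU Up smF Mp MF dimT TM Dv H0_adm H0_nondeg.
split=> [H aH|].
  exact: (hessian_nondegenerate oU Up smF Mp MF dimT TM Dv aH nd).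
have [e eT] : exists e : n.-tuple 'rV[R]_n.+2, basis_of T e.
  by exists (tcast dimT (vbasis T)); rewrite val_tcast; exact: vbasisP.
have [P dP PP] := normal_plane oU Up smF Mp MF TM Dv eT nd.
exists P; split=> // H aH u [xi0 [eta [_ bl <-]]]; apply: PP => k.
have [w [wH Dw ew]] :=
  conjugate_transversal oU Up smF Mp MF dimT TM Dv eT nd aH.
exact: (affine_normal_eq oU Up smF Mp MF dimT TM Dv eT nd aH bl wH Dw ew).
Qed.
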